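(* If $X$ is a first countable Urysohn strongly cellular-Lindelöf space, then $|X|\le\mathfrak c$. In particular, if $X$ is a first countable Urysohn cellular-compact space, then $|X|\le\mathfrak c$.
   Context: $\mathfrak c=2^{\omega}$ is the cardinality of the continuum. A space is Urysohn if any two distinct points have disjoint closed neighbourhoods. A space is Lindelöf if every open cover of it has a countable subcover. A space $X$ is strongly cellular-Lindelöf if for every collection $\mathcal U$ of pairwise disjoint non-empty open subsets of $X$ there is a closed Lindelöf subspace $Y\subseteq X$ such that $Y\cap U\neq\emptyset$ for each $U\in\mathcal U$. A space $X$ is cellular-compact if for every collection $\mathcal U$ of pairwise disjoint non-empty open subsets of $X$ there is a compact subspace $K\subseteq X$ such that $K\cap U\neq\emptyset$ for each $U\in\mathcal U$. *)

(* Defs.v *)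
From mathcomp Require Export all_boot all_classical.
From mathcomp Require Export topology.

Set Implicit Arguments.
Unset Strict Implicit.
Unset Printing Implicit Defensive.

Local Open Scope classical_set_scope.

Definition first_countable (T : topologicalType) :=
  forall x : T, exists B : set (set T),
    [/\ countable B,
        (forall V, B V -> open_nbhs x V) &
        forall U, nbhs x U -> exists2 V, B V & V `<=` U].

Definition urysohn_space (T : topologicalType) :=
  forall x y : T, x <> y -> exists A B : set T,
    [/\ nbhs x A /\ closed A, nbhs y B /\ closed B & A `&` B = set0].

Definition lindelof_space (T : topologicalType) :=
  forall U : set (set T), (forall V, U V -> open V) ->
    \bigcup_(V in U) V = [set: T] ->
  exists W : set (set T),
    [/\ W `<=` U, countable W & \bigcup_(V in W) V = [set: T]].

Definition cellular_family (T : topologicalType) (U : set (set T)) :=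
  (forall V, U V -> open V /\ V !=set0) /\ trivIset U id.

(* set_type Y carries the subspace topology, i.e. the initial topology for the
   inclusion of Y in T. *)
Definition strongly_cellular_lindelof (T : topologicalType) :=
  forall U : set (set T), cellular_family U ->
  exists Y : set T,
    [/\ closed Y, lindelof_space (set_type Y) &
        forall V, U V -> Y `&` V !=set0].

Definition cellular_compact (T : topologicalType) :=
  forall U : set (set T), cellular_family U ->
  exists2 K : set T, compact K & forall V, U V -> K `&` V !=set0.

(* Main.v *)
From HB Require Import structures.
Require Import Defs.
From mathcomp Require wochoice.

Set Implicit Arguments.
Unset Strict Implicit.
Unset Printing Implicit Defensive.

Local Open Scope classical_set_scope.
Local Open Scope card_scope.

(** Write SL for the conclusion of strong cellular-Lindelöfness: each cellular
family is met by a closed Lindelöf set.  Cellular-compact Hausdorff spaces have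
it too, so both parts follow from one bound ([first_countable_urysohn_card]).

Two facts about a first countable Hausdorff space [T] with SL carry the proof.

First, if the points [x j] lie in pairwise disjoint open sets [G j], then a
single closed Lindelöf set contains all of them
([strongly_discrete_lindelof]).  Inside [G j] one finds a cellular family with
members in every neighbourhood of [x j] ([cellular_converging]); a closed set
that meets every member contains [x j].

Second, [T] is weakly Lindelöf with respect to closed sets
([closed_weakly_lindelof]): if open sets [V h] around the points [h] of a closed
set [H] are given, then countably many of them have a union whose closure
contains [H].  Otherwise, recursion along [omega_1] picks points [x i] of [H]
outside the closure of the union of countably many [V h], namely those around
the earlier points and those covering the closure of each earlier initial
segment.  These points can be separated by disjoint open sets, so by the first
fact the closure of the whole sequence is Lindelöf, and so is the closure of
each initial segment (which is what provides the countable covers).  By first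
countability and regularity of [omega_1] the closure of the sequence is the
union of the closures of its initial segments, hence is covered by the
[omega_1] many open sets chosen along the way.  Countably many of them do not
suffice, since later points of the sequence avoid them all.

The cardinal bound is then a closing-off argument.  Fix countable decreasing
bases [b x].  Let [H] be a set of at most continuum many points that contains
the limit of each of its sequences that converges in the theta sense, and a
point outside the closure of each non-dense union of sets [b (a n) (k n)] with
[a n] in [H].  Limits in the theta sense are unique in a Urysohn space, so [H]
is the closure of a point under countably-ary operations, indexed by
[nat -> nat]; such a closure is an image of the set of countably branching
well-founded trees, which has the cardinality of the continuum
([countable_operation_closure]).  If [p] were not in [H], some neighbourhood [U]
of [p] would have a closure disjoint from [H], and each [h] in [H] would have a
basic neighbourhood missing [U].  The second fact gives countably many of these
whose union is dense in [H]; that union misses [U], so it is not dense in the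
space, and [H] contains a point outside its closure, a contradiction. *)

(** * Countable sets and the first uncountable well-order *)
Lemma countable_enum (T : Type) (A : set T) :
  countable A -> A !=set0 -> exists f : nat -> T, range f = A.
Proof.
move=> /pfcard_geP [->|[f] _]; first by case.
exists f; apply/seteqP; split=> [_ [n _ <-]|a /(@surj _ _ _ _ f) [n _ <-]].
  exact: funS.
by exists n.
Qed.

Lemma countable_setU (T : Type) (A B : set T) :
  countable A -> countable B -> countable (A `|` B).
Proof.
move=> cA cB.
have -> : A `|` B = \bigcup_(c in [set: bool]) (if c then A else B).
  by apply/seteqP; split=> [x [Ax|Bx]|x [[] _ ?]]; [exists true | exists false | left | right].
by apply: bigcup_countable => // -[].
Qed.

(** Cantor's diagonal argument. *)
Lemma uncountable_set_nat : ~ countable [set: set nat].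
Proof.
move/countable_injP => [f finj].
pose D := [set n | exists2 A, f A = n & ~ A n].
have DN : ~ D (f D).
  move=> [A fA An]; have AD : A = D by apply: finj; rewrite ?inE.
  by apply: (An); rewrite AD; exists A.
by apply: (DN); exists D.
Qed.

(** The well-ordering principle in strict form, which is the shape needed for
recursion. *)
Lemma well_order_exists (T : eqType) : exists lt : T -> T -> Prop,
  [/\ well_founded lt,
      forall a b, [\/ lt a b, a = b | lt b a] &
      forall a b c, lt a b -> lt b c -> lt a c].
Proof.
have [R Rwo] := wochoice.well_ordering_principle T.
have Rmin (A : set T) : A !=set0 -> exists2 z, A z & forall x, A x -> R z x.
  move=> [a Aa]; have [|z [[zA zmin] _]] := Rwo (mem A).
    by exists a; rewrite inE.
  by exists z => [|x Ax]; [rewrite inE in zA | apply: zmin; rewrite inE].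
have Rtot a b : R a b \/ R b a.
  have [|z [->|->] zmin] := Rmin [set a; b]; first by exists a; left.
    by left; apply: zmin; right.
  by right; apply: zmin; left.
have Rxx x : R x x by case: (Rtot x x).
have Ranti a b : R a b -> R b a -> a = b.
  move=> ab ba; have [|z [_ zu]] := Rwo (mem [set a; b]).
    by exists a; rewrite inE; left.
  have za : z = a.
    by apply: zu; split; [rewrite inE; left | move=> x; rewrite inE => -[->|->]].
  rewrite -za; apply: zu.
  by split; [rewrite inE; right | move=> x; rewrite inE => -[->|->]].
pose lt a b := R a b /\ a <> b; exists lt.
have ltP a b : [\/ lt a b, a = b | lt b a].
  have [->|ab] := pselect (a = b); first by constructor 2.
  by case: (Rtot a b); [constructor 1 | constructor 3; split=> // /esym].
split; [move=> a | exact: ltP | move=> a b c ab bc].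
  apply: contrapT => nPa.
  have [|z nPz zmin] := Rmin (~` Acc lt); first by exists a.
  apply: nPz; constructor=> b [bz nbz]; apply: contrapT => nPb.
  by apply: nbz; apply: Ranti => //; apply: zmin.
have [|z zabc zmin] := Rmin [set a; b; c]; first by exists a; left; left.
have [Rza Rzb Rzc] : [/\ R z a, R z b & R z c].
  by split; apply: zmin; [left; left | left; right | right].
move: ab bc; rewrite /lt; case: zabc => [[|]|] <- [ab nab] [bc nbc].
- by split=> // zc; apply: nbc; apply: Ranti => //; rewrite -zc.
- by case: nab; apply: Ranti.
- by case: nbc; apply: Ranti.
Qed.

(** The points of a well-ordered uncountable type with countably many
predecessors form a copy of [omega_1].  The last clause says that its cofinality
is uncountable; with [E] empty it also says that [I] is inhabited. *)
Lemma omega1_exists : exists (I : Type) (lt : I -> I -> Prop),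
  [/\ well_founded lt,
      forall i j, [\/ lt i j, i = j | lt j i],
      forall i j k, lt i j -> lt j k -> lt i k,
      forall i, countable [set j | lt j i] &
      forall E : set I, countable E -> exists i, forall j, E j -> lt j i].
Proof.
have [T T_unc] : exists T : eqType, ~ countable [set: T].
  by exists (set nat); exact: uncountable_set_nat.
have [lt [lt_wf ltP lt_trans]] := well_order_exists T.
pose S := [set a | countable [set b | lt b a]].
have S_unc : ~ countable S.
  (* If S were countable, every point with all predecessors in S would be in S,
     so S would be everything by induction. *)
  move=> cS; apply: T_unc; suff -> : [set: T] = S by [].
  apply/seteqP; split=> // a _; elim/(well_founded_ind lt_wf): a => a IH.
  exact: (sub_countable (subset_card_le IH)).
have cnt (A : set T) : countable A -> countable [set i : {a | S a} | A (sval i)].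
  move=> /countable_injP [f finj]; apply/countable_injP.
  exists (f \o sval) => -[i Si] [j Sj]; rewrite !inE /= => Ai Aj fij.
  by apply: eq_exist; apply: finj; rewrite ?inE.
exists {a | S a}, (fun i j => lt (sval i) (sval j)); split.
- move=> [a Sa]; elim/(well_founded_ind lt_wf): a Sa => a IH Sa.
  by constructor=> -[b Sb] /= ba; apply: IH.
- move=> [i Si] [j Sj] /=; have [ij|ij|ij] := ltP i j.
  + by constructor 1.
  + by constructor 2; apply: eq_exist.
  + by constructor 3.
- by move=> i j k; exact: lt_trans.
- by move=> [a Sa]; apply: (cnt [set b | lt b a]).
- move=> E cE; apply: contrapT => /forallNP unb; apply: S_unc.
  (* An unbounded countable E would exhaust S by countably many countable
     initial segments. *)
  have : countable (\bigcup_(i in E) ([set sval i] `|` [set b | lt b (sval i)])).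
    apply: bigcup_countable => // -[i Si] _ /=.
    by apply: countable_setU => //; exact: countable1.
  apply: sub_countable; apply: subset_card_le => a Sa.
  have /existsNP [j /not_implyP [Ej /= ja]] := unb (exist _ a Sa).
  by exists j => //; case: (ltP (sval j) a) => [//|<-|aj]; [left | right].
Qed.

(** Recursion for operators given on total functions: [G i x] may be written
as if all of [x] were available, as long as it only reads values below [i]. *)
Lemma wf_recursion (I X : Type) (lt : I -> I -> Prop) (x0 : X)
    (G : I -> (I -> X) -> X) :
  well_founded lt ->
  (forall i x y, (forall j, lt j i -> x j = y j) -> G i x = G i y) ->
  exists x, forall i, x i = G i x.
Proof.
move=> wf Gloc.
pose ext i (r : forall j, lt j i -> X) j :=
  if pselect (lt j i) is left p then r j p else x0.
pose x := Fix wf (fun=> X) (fun i r => G i (ext i r)).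
exists x => i; rewrite /x Fix_eq => [|{}i f g fg].
  by apply: Gloc => j ji; rewrite /ext; case: pselect.
by apply: Gloc => j ji; rewrite /ext; case: pselect.
Qed.

(** * Closing off under countably-ary operations *)

(** Terms over one constant and operations of arity [nat] indexed by
[nat -> nat]. *)
Inductive ctree := Leaf | Node of (nat -> nat) & (nat -> ctree).

(** A term is determined by the labels along all finite branches; the shift by
one distinguishes [Node] from [Leaf]. *)
Fixpoint ctree_code (t : ctree) (s : seq nat) : nat -> nat :=
  match t, s with
  | Leaf, _ => fun=> 0
  | Node k _, [::] => fun n => (k n).+1
  | Node _ f, m :: s' => ctree_code (f m) s'
  end.

Lemma ctree_code_inj : injective ctree_code.
Proof.
elim=> [|k f IH] [|l g] // /funeqP E.
- by have /funeqP/(_ 0) := E [::].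
- by have /funeqP/(_ 0) := E [::].
congr Node.
  by apply/funext => n; have /funeqP/(_ n) [] := E [::].
by apply/funext => m; apply: IH; apply/funext => s; exact: (E (m :: s)).
Qed.

Lemma card_ctree : [set: ctree] #<= [set: nat -> bool].
Proof.
pose graph (h : seq nat -> nat -> nat) (m : nat) : bool :=
  if unpickle m is Some (s, n, v) then h s n == v else false.
apply/pcard_injP.
exists (graph \o ctree_code) => t u _ _ /funeqP E; apply: ctree_code_inj.
apply/funext => s; apply/funext => n.
have := E (pickle (s, n, ctree_code u s n)).
by rewrite /graph /= pickleK eqxx => /eqP.
Qed.

(** The generated set consists of the values of terms; well-founded terms make
a transfinite iteration of length [omega_1] unnecessary. *)
Lemma countable_operation_closure (X : Type) (x0 : X)
    (Phi : (nat -> nat) -> (nat -> X) -> X) :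
  exists H : set X, [/\ H x0, H #<= [set: nat -> bool] &
    forall k a, (forall n, H (a n)) -> H (Phi k a)].
Proof.
pose fix ev (t : ctree) : X :=
  if t is Node k f then Phi k (fun n => ev (f n)) else x0.
exists (range ev); split; first by exists Leaf.
  exact: (card_le_trans (card_image_le ev _) card_ctree).
move=> k a /(_ _)/cid2-/all_sig2 [f _ fa].
by exists (Node k f) => //=; congr Phi; apply/funext.
Qed.

(** * Lindelöf subsets *)
Lemma first_countable_basis (T : topologicalType) : first_countable T ->
  exists b : T -> nat -> set T,
    [/\ forall x n, open_nbhs x (b x n),
        forall x m n, (m <= n)%N -> b x n `<=` b x m &
        forall x U, nbhs x U -> exists n, b x n `<=` U].
Proof.
move=> fc; suff /choice [b bP] (x : T) : exists b : nat -> set T,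
    [/\ forall n, open_nbhs x (b n),
        forall m n, (m <= n)%N -> b n `<=` b m &
        forall U, nbhs x U -> exists n, b n `<=` U].
  by exists b; split=> x; case: (bP x).
have [B [cB Bo Bb]] := fc x.
have [|c cB'] := countable_enum cB.
  by have [V BV _] := Bb setT filterT; exists V.
pose fix d n := if n is m.+1 then d m `&` c n else c 0.
have co n : open_nbhs x (c n) by apply: Bo; rewrite -cB'; exists n.
exists d; split=> [|m n /subnK <-|U /Bb [V]].
- by elim=> [|n IH] /=; [exact: co | exact: open_nbhsI].
- by elim: (n - m)%N => [|k IH] //=; apply: subset_trans IH => y [].
- rewrite -cB' => -[n _ <-] cU; exists n; apply: subset_trans cU.
  by case: n => [|n] //= y [].
Qed.

Lemma urysohn_hausdorff (T : topologicalType) :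
  urysohn_space T -> hausdorff_space T.
Proof.
move=> uT x y xy; apply: contrapT => /uT [A [B [[xA _] [yB _] AB]]].
by have [z] := xy _ _ xA yB; rewrite AB.
Qed.

(** Covers are by open sets of the ambient space and indexed, so that a
countable subcover can be pulled back to the indices. *)
Definition lindelof_set (T : topologicalType) (Y : set T) :=
  forall (I : Type) (D : set I) (F : I -> set T),
    (forall i, D i -> open (F i)) -> Y `<=` \bigcup_(i in D) F i ->
  exists E : set I, [/\ E `<=` D, countable E & Y `<=` \bigcup_(i in E) F i].

Lemma lindelof_set_type (T : topologicalType) (Y : set T) :
  lindelof_space (set_type Y) -> lindelof_set Y.
Proof.
move=> lY I D F Fo YF.
pose U := [set (set_val : Y -> T) @^-1` F i | i in D].
have [||W [WU cW WT]] := lY U.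
- by move=> _ [i Di <-]; exists (F i) => //; exact: Fo.
- apply/seteqP; split=> // y _; have [i Di Fy] := YF _ (set_valP y).
  by exists (set_val @^-1` F i) => //; exists i.
have /choice [g gP] (w : {w | W w}) :
    exists i, D i /\ (set_val : Y -> T) @^-1` F i = sval w.
  by case: w => w /= /WU [i Di <-]; exists i.
have cg : countable [set: {w | W w}].
  move/countable_injP: cW => [f finj]; apply/countable_injP.
  exists (f \o sval) => -[i Wi] [j Wj] _ _ /= fij.
  by apply: eq_exist; apply: finj; rewrite ?inE.
exists (range g); split=> [_ [w _ <-]||y Yy]; first by case: (gP w).
  exact: (sub_countable (card_image_le g _)).
have : [set: Y] (SigSub (mem_set Yy)) by [].
rewrite -WT => -[w Ww wy]; exists (g (exist _ w Ww)); first by exists (exist _ w Ww).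
by have [_ gw] := gP (exist _ w Ww); move: wy; rewrite -[w in w _]gw.
Qed.

Lemma compact_lindelof_set (T : topologicalType) (K : set T) :
  compact K -> lindelof_set K.
Proof.
move=> cK I D F Fo KF.
have [->|/set0P [x0 _]] := eqVneq K set0; first by exists set0; split.
pose T' : ptopologicalType := HB.pack T (isPointed.Build T x0).
have : @cover_compact T' K by rewrite -compact_cover.
move=> /(_ {classic I} D F Fo KF) [E ED KE].
eexists; split; [|exact: (countable_fset E)|exact: KE].
by move=> i /= /ED /set_mem.
Qed.

(** The complement of [Z], indexed by [None], completes a cover of [Z] to one
of [Y]. *)
Lemma lindelof_set_closed (T : topologicalType) (Y Z : set T) :
  lindelof_set Y -> closed Z -> Z `<=` Y -> lindelof_set Z.
Proof.
move=> lY cZ ZY I D F Fo ZF.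
pose D' := [set o : option I | if o is Some i then D i else True].
pose F' o := if o is Some i then F i else ~` Z.
have [||E [ED cE YE]] := lY _ D' F'.
- by move=> [i|] //= Di; [exact: Fo | exact: closed_openC].
- move=> y Yy; have [/ZF [i Di Fy]|nZ] := pselect (Z y); last by exists None.
  by exists (Some i).
exists [set i | E (Some i)]; split=> [i /ED //||z Zz].
  move/countable_injP: cE => [f finj]; apply/countable_injP.
  exists (f \o Some) => i j; rewrite !inE /= => Ei Ej fij.
  by have := finj (Some i) (Some j); rewrite !inE => /(_ Ei Ej fij) [].
by have [[i|] Ei Fz] := YE _ (ZY _ Zz); [exists i | case: Fz].
Qed.

(** * Points separated by disjoint open sets *)
Definition cellular_lindelof_sets (T : topologicalType) :=
  forall U : set (set T), cellular_family U ->
  exists Y : set T, [/\ closed Y, lindelof_set Y &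
        forall V, U V -> Y `&` V !=set0].

(** At an isolated point the singleton will do.  Otherwise there are open
neighbourhoods [N n] of [x], each contained in the [n]-th basic one and with
[closure (N n.+1)] not containing [N n]; the differences form the family. *)
Lemma cellular_converging (T : topologicalType) (x : T) (G : set T) :
  first_countable T -> hausdorff_space T -> open_nbhs x G ->
  exists U : set (set T), [/\ cellular_family U, forall V, U V -> V `<=` G &
    forall W, nbhs x W -> exists2 V, U V & V `<=` W].
Proof.
move=> fc hT [Go Gx].
have [xo|xno] := pselect (open [set x]).
  exists [set [set x]]; split=> [|_ -> _ -> //|W /nbhs_singleton Wx].
    by split=> [_ ->|_ _ -> -> //]; split=> //; exists x.
  by exists [set x] => // _ ->.
have [b [bo _ bx]] := first_countable_basis fc.
have /choice [next nextP] (N : set T) : exists N', open_nbhs x N ->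
    [/\ open_nbhs x N', N' `<=` N & N `\` closure N' !=set0].
  have [[No Nx]|] := pselect (open_nbhs x N); last by exists set0.
  have [y Ny yx] : exists2 y, N y & y != x.
    apply: contrapT => /forall2NP Nx'; apply: xno.
    suff -> : [set x] = N by [].
    apply/seteqP; split=> [_ -> //|y Ny]; have [//|/negP] := Nx' y.
    by rewrite negbK => /eqP.
  move: hT; rewrite open_hausdorff => /(_ _ _ yx).
  move=> [[P Q] /= [/set_mem Py /set_mem Qx] [Po Qo /eqP PQ]].
  exists (N `&` Q) => _; split; [by split; [exact: openI|] | by move=> ? [] |].
  exists y; split=> // /(_ P) [|z [[_ Qz] Pz]].
    by apply: open_nbhs_nbhs.
  by have : (P `&` Q) z by []; rewrite PQ.
pose fix N n := if n is m.+1 then next (N m) `&` b x m else G.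
have No n : open_nbhs x (N n).
  elim: n => [|n IH] //=; apply: open_nbhsI (bo x n).
  by have [] := nextP _ IH.
have Ndec m n : (m <= n)%N -> N n `<=` N m.
  move=> /subnK <-; elim: (n - m)%N => [|k IH] //=; apply: subset_trans IH.
  by move=> y [+ _]; have [_ + _] := nextP _ (No (k + m)%N); apply.
pose u n := N n `\` closure (N n.+1).
have uN n : u n !=set0.
  have [_ _ [y [Ny yN]]] := nextP _ (No n); exists y; split=> //.
  by apply: contra_not yN; apply: closureS => z [].
have ulow m n : (m < n)%N -> u m `&` u n = set0.
  move=> mn; apply/seteqP; split=> // y [[_ ym] [yn _]]; apply: ym.
  by apply: subset_closure; apply: Ndec yn.
exists (range u); split=> [|_ [n _ <-]|W /bx [n bW]].
- split=> [_ [n _ <-]|_ _ [m _ <-] [n _ <-]].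
    split=> //; apply: openI; first by case: (No n).
    exact: closed_openC (@closed_closure _ _).
  by case: (ltngtP m n) => [/ulow|/ulow|-> //]; rewrite 1?setIC => -> [].
- by move=> y [+ _]; exact: (Ndec 0).
- by exists (u n.+1) => [|y [[_ /bW]]] //; exists n.+1.
Qed.

(** The union over [j] of families converging to [x j] inside [G j] is still
cellular, and a closed set that meets all its members contains each [x j]. *)
Lemma strongly_discrete_lindelof (T : topologicalType) (J : Type) (x : J -> T)
    (G : J -> set T) :
  first_countable T -> hausdorff_space T -> cellular_lindelof_sets T ->
  (forall j, open_nbhs (x j) (G j)) ->
  (forall i j, G i `&` G j !=set0 -> i = j) ->
  exists Y, [/\ closed Y, lindelof_set Y & forall j, Y (x j)].
Proof.
move=> fc hT cl Gx Gd.
have /choice [U UP] j := cellular_converging fc hT (Gx j).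
have [|Y [Yc Yl YU]] := cl (\bigcup_j U j).
  split=> [V [j _ UV]|V W [i _ UV] [j _ UW] [y [Vy Wy]]].
    by have [[+ _] _ _] := UP j; apply.
  have ij : i = j.
    apply: Gd; exists y.
    by have [_ /(_ _ UV) + _] := UP i; have [_ /(_ _ UW) + _] := UP j; split; auto.
  rewrite -ij in UW; have [[_ tU] _ _] := UP i; apply: tU => //; by exists y.
exists Y; split=> // j; apply: Yc => W xW.
have [_ _ /(_ _ xW) [V UV VW]] := UP j.
have [|y [Yy Vy]] := YU V; first by exists j.
by exists y; split=> //; apply: VW.
Qed.

(** * Weak Lindelöfness of closed subsets *)

(** A failure yields an [omega_1]-sequence of points with disjoint open
expansion whose closure is covered by [omega_1] open sets without countable
subcover. *)
Lemma closed_weakly_lindelof (T : topologicalType) (H : set T) (V : T -> set T) :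
  first_countable T -> hausdorff_space T -> cellular_lindelof_sets T ->
  closed H -> (forall h, H h -> open_nbhs h (V h)) ->
  exists A, [/\ A `<=` H, countable A & H `<=` closure (\bigcup_(a in A) V a)].
Proof.
move=> fc hT cl Hc HV.
have [->|/set0P [h0 Hh0]] := eqVneq H set0; first by exists set0; split.
apply: contrapT => noA.
have [I [lt [lt_wf ltP lt_trans seg_c lt_bnd]]] := omega1_exists.
pose st (A : set T) := \bigcup_(a in A) V a.
pose small (A : set T) := A `<=` H /\ countable A.
pose cov (C : set T) : set (set T) := [set A | small A /\ closure C `<=` st A].
pose A_ C := xget set0 (cov C).
(* A_ C is a countable subset of H in every case, a cover of closure C only when
   one exists; likewise the points picked below always lie in H.  These defaults
   keep the recursion free of side conditions. *)
have A_small C : small (A_ C).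
  rewrite /A_; case: xgetP => [A _ [] //|_]; first by split.
pose below (x : I -> T) i := [set x j | j in [set j | lt j i]].
pose N (x : I -> T) i :=
  below x i `|` \bigcup_(j in [set j | lt j i]) A_ (below x j).
pose pickx x i := xget h0 [set h | H h /\ ~ closure (st (N x i)) h].
have below_ext (x y : I -> T) i : (forall j, lt j i -> x j = y j) ->
    below x i = below y i.
  by move=> xy; apply: eq_imagel => j /= /xy.
have [|x xE] := @wf_recursion I T lt h0 (fun i x => pickx x i) lt_wf.
  move=> i x y xy; rewrite /pickx /N (below_ext _ _ _ xy).
  suff -> : \bigcup_(j in [set j | lt j i]) A_ (below x j) =
            \bigcup_(j in [set j | lt j i]) A_ (below y j) by [].
  apply: eq_bigcupr => j /= ji; congr A_; apply: below_ext => k kj.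
  by apply: xy; apply: lt_trans kj ji.
have xH i : H (x i) by rewrite xE /pickx; case: xgetP => [? _ []|].
have N_small i : small (N x i).
  split=> [y [[j _ <-] //|[j _ Ay]]|]; first by have [+ _] := A_small (below x j); apply.
  apply: countable_setU; first exact: sub_countable (card_image_le _ _) (seg_c i).
  by apply: bigcup_countable => // j _; have [] := A_small (below x j).
(* The countable set N x i is not a witness for the conclusion, so there was a
   genuine choice at stage i. *)
have xN i : ~ closure (st (N x i)) (x i).
  have [h [Hh hN]] : exists h, H h /\ ~ closure (st (N x i)) h.
    apply: contrapT => /forallNP hN; apply: noA; exists (N x i).
    have [NH Nc] := N_small i; split=> // h Hh; apply: contrapT => nh.
    by apply: (hN h).
  rewrite xE /pickx; case: xgetP => [? _ []//|/(_ h) []]; by split.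
pose G i := V (x i) `&` ~` closure (st (N x i)).
have Gx i : open_nbhs (x i) (G i).
  have [Vo Vx] := HV _ (xH i); split; last by split; [|exact: xN].
  by apply: openI => //; exact: closed_openC (@closed_closure _ _).
(* N x j contains x i, so G j avoids V (x i). *)
have Glt i j : lt i j -> G i `&` G j = set0.
  move=> ij; apply/seteqP; split=> // y [[Vy _] [_ []]].
  apply: subset_closure; exists (x i) => //; left; by exists i.
have [|Y [Yc Yl Yx]] := strongly_discrete_lindelof fc hT cl Gx.
  by move=> i j; case: (ltP i j) => [/Glt||/Glt]; rewrite 1?setIC // => -> [].
have clYH C : C `<=` range x -> closure C `<=` Y `&` H.
  move=> Cx; have /closure_id -> : closed (Y `&` H) by exact: closedI.
  by apply: closureS => _ /Cx [i _ <-]; split.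
have cl_lind C : C `<=` range x -> lindelof_set (closure C).
  move=> Cx; apply: lindelof_set_closed Yl (@closed_closure _ _) _.
  by move=> y /(clYH _ Cx) [].
have A_cov i : closure (below x i) `<=` st (A_ (below x i)).
  rewrite /A_; case: xgetP => [? _ [] //|noC].
  have Cx : below x i `<=` range x by move=> _ [j _ <-]; exists j.
  have [||E [EH Ec CE]] := cl_lind _ Cx T H V.
  - by move=> h /HV [].
  - by move=> y /(clYH _ Cx) [_ Hy]; exists y => //; case: (HV _ Hy).
  by case: (noC E); split.
have [b [bo _ bx]] := first_countable_basis fc.
have clx : closure (range x) `<=` \bigcup_i closure (below x i).
  move=> p px; have /choice [f fP] n : exists i, b p n (x i).
    have [|_ [[i _ <-] bi]] := px (b p n); last by exists i.
    exact: open_nbhs_nbhs.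
  have [i fi] := lt_bnd (range f) (sub_countable (card_image_le f _) (countableP _)).
  exists i => // U /bx [n bU]; exists (x (f n)); split; last exact/bU.
  by exists (f n) => //; apply: fi; exists n.
have [||E [_ Ec xE']] := cl_lind (range x) (@subset_refl _ _) I setT
    (fun i => st (A_ (below x i))).
- move=> i _; apply: bigcup_open => a Aa; have [AH _] := A_small (below x i).
  by case: (HV _ (AH _ Aa)).
- by move=> p /clx [i _ /A_cov]; exists i.
(* A stage i above all indices in E has N x i containing every set A_ used by the
   countable subcover. *)
have [i Ei] := lt_bnd E Ec; apply: (xN i).
have [|j Ej [a Aa Va]] := xE' (x i).
  by apply: subset_closure; exists i.
apply: subset_closure; exists a => //; right; exists j => //; exact: Ei.
Qed.

(** * The cardinal bound *)

(** Closing-off: [H] is stable under theta-limits and under escaping from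
non-dense countable unions of basic sets; weak Lindelöfness of [H] shows that it
is the whole space. *)
Lemma first_countable_urysohn_card (T : topologicalType) :
  first_countable T -> urysohn_space T -> cellular_lindelof_sets T ->
  [set: T] #<= [set: nat -> bool].
Proof.
move=> fc uT cl; have hT := urysohn_hausdorff uT.
have [->|/set0P [x0 _]] := eqVneq [set: T] set0; first exact: card_ge0.
have [b [bo bdec bx]] := first_countable_basis fc.
pose tlim (a : nat -> T) : set T := [set x | forall U, nbhs x U ->
  exists m, forall n, (m <= n)%N -> closure U (a n)].
have tlim_uniq a x y : tlim a x -> tlim a y -> x = y.
  move=> ax ay; apply: contrapT => /uT [A [B [[xA cA] [yB cB] AB]]].
  have [m mA] := ax _ xA; have [n nB] := ay _ yB.
  have : (A `&` B) (a (maxn m n)).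
    by split; [apply/cA/mA/leq_maxl | apply/cB/nB/leq_maxr].
  by rewrite AB.
pose out (k : nat -> nat) (a : nat -> T) :=
  ~` closure (\bigcup_n b (a n) (k n)).
(* One family of operations encodes both: the value k 0 selects the operation,
   and the remaining values of k are its parameters. *)
have [H [Hx0 Hcard Hop]] := countable_operation_closure x0
  (fun k a => if k 0 is 0 then xget x0 (tlim a) else xget x0 (out (k \o S) a)).
have Htlim a x : (forall n, H (a n)) -> tlim a x -> H x.
  move=> Ha ax; have := Hop (fun=> 0) a Ha => /=.
  by case: xgetP => [y _ /tlim_uniq/(_ ax) <- //|/(_ x)].
have Hout k a : (forall n, H (a n)) -> out k a !=set0 -> exists2 x, H x & out k a x.
  move=> Ha [x ax]; have := Hop (fun n => if n is m.+1 then k m else 1) a Ha => /=.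
  by case: xgetP => [y _ ay Hy|/(_ x)//]; exists y.
(* Choosing points of H in the closures of the decreasing basic neighbourhoods
   of p gives a sequence with theta-limit p. *)
have Htcl p : (forall U, nbhs p U -> closure U `&` H !=set0) -> H p.
  move=> pH; have /choice [a aP] n : exists y, closure (b p n) y /\ H y.
    by have [|y] := pH (b p n); [exact: open_nbhs_nbhs | exists y].
  apply: (Htlim a) => [n|U /bx [m mU]]; first by case: (aP n).
  exists m => n mn; have [+ _] := aP n; apply: closureS.
  by apply: subset_trans mU; apply: bdec.
have Hc : closed H.
  move=> p pH; apply: Htcl => U /pH [y [Hy Uy]]; exists y; split=> //.
  exact: subset_closure.
suff -> : [set: T] = H by [].
apply/seteqP; split=> // p _; apply: contrapT => nHp.
have /existsNP [U /not_implyP [pU UH]] : ~ forall U, nbhs p U -> closure U `&` H !=set0.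
  by move=> /Htcl.
have /choice [k kP] h : exists n, H h -> b h n `&` U = set0.
  have [Hh|nHh] := pselect (H h); last by exists 0.
  have : ~ closure U h by move=> hU; apply: UH; exists h.
  move=> /existsNP [W /not_implyP [/bx [n nW] UW]]; exists n => _.
  apply/seteqP; split=> // y [/nW Wy Uy]; apply: UW; by exists y.
have [|A [AH Ac HA]] := @closed_weakly_lindelof T H (fun h => b h (k h)) fc hT cl Hc.
  by move=> h _; exact: bo.
have [|a aA] := countable_enum Ac.
  have [y [[a Aa _] _]] := HA _ Hx0 setT filterT; by exists a.
have stE : \bigcup_n b (a n) (k (a n)) = \bigcup_(h in A) b h (k h).
  by rewrite -aA bigcup_image.
have Ha n : H (a n) by apply: AH; rewrite -aA; exists n.
have [|q Hq] := Hout (k \o a) a Ha.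
  exists p => /(_ U pU) [y []]; rewrite /= stE => -[h Ah bhy] Uy.
  by have := kP h (AH _ Ah) => /seteqP [/(_ y) + _]; apply.
by apply; rewrite /= stE; exact: HA.
Qed.

Theorem corollary4 (X : topologicalType) :
  (first_countable X -> urysohn_space X -> strongly_cellular_lindelof X ->
     [set: X] #<= [set: nat -> bool])
  /\
  (first_countable X -> urysohn_space X -> cellular_compact X ->
     [set: X] #<= [set: nat -> bool]).
Proof.
split=> fc uX cX; apply: first_countable_urysohn_card => // U /cX.
  by move=> [Y [Yc /lindelof_set_type Yl YU]]; exists Y.
move=> [K cK KU]; exists K; split=> //; last exact: compact_lindelof_set.
exact: compact_closed (urysohn_hausdorff uX) cK.
Qed.
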